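(* Let $\mu_1,\mu_2,d_1,d_2\in\mathbb{C}$ with $|\mu_1|\leq 1$ and $|\mu_2|\leq 1$, and let $\Phi_1(z)=\mu_1 z+d_1$ and $\Phi_2(z)=\mu_2 z+d_2$ for $z\in\mathbb{C}$, such that $C_{\Phi_1}$ and $C_{\Phi_2}$ are bounded on $H_E(\xi)$. Then the product $C_{\Phi_2}C_{\Phi_1}$ is an isometry on $H_E(\xi)$ if and only if $|\mu_1|=1$, $|\mu_2|=1$ and $\mu_1 d_2+d_1=0$. Moreover, the product $C_{\Phi_2}C_{\Phi_1}$ is unitary on $H_E(\xi)$ if and only if $|\mu_1|=1$, $|\mu_2|=1$ and $\mu_1 d_2+d_1=0$.
   Context: Let $\xi=(\xi_n)_{n\ge 0}$ be a sequence of positive real numbers with $\lim_{n\to\infty}\xi_n^{1/n}=\infty$. $H_E(\xi)$ is the Hilbert space of entire functions $f(z)=\sum_{n=0}^\infty a_n z^n$ with $\|f\|^2=\sum_{n=0}^\infty |a_n|^2\xi_n^2<\infty$, with inner product $\langle f,g\rangle=\sum_{n=0}^\infty b_n\overline{c_n}\,\xi_n^2$ for $f=\sum b_nz^n$, $g=\sum c_nz^n$. For an entire function $\Phi$, the composition operator is $C_\Phi f=f\circ\Phi$. A bounded operator $S$ is an isometry if $\|Sx\|=\|x\|$ for all $x$ (equivalently $S^*S=I$), and unitary if $S^*S=SS^*=I$. *)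

(* Defs.v *)
(* Stdlib reals with Coquelicot. *)
From Stdlib Require Import Reals ClassicalEpsilon.
From Coquelicot Require Import Coquelicot.

Open Scope R_scope.

Definition expands (f : C -> C) (a : nat -> C) : Prop :=
  forall z : C, @is_pseries C_AbsRing C_NormedModule a z (f z).

(* Power series coefficients are unique, so the choice below is canonical
   whenever [f] is entire; otherwise the value is unspecified. *)
Definition coef (f : C -> C) : nat -> C :=
  epsilon (inhabits (fun _ : nat => RtoC 0)) (expands f).

Definition H_E (xi : nat -> R) (f : C -> C) : Prop :=
  exists a : nat -> C,
    expands f a /\ ex_series (fun n => Cmod (a n) ^ 2 * xi n ^ 2).

Definition normH (xi : nat -> R) (f : C -> C) : R :=
  sqrt (Series (fun n => Cmod (coef f n) ^ 2 * xi n ^ 2)).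

(* The sum of a complex series, taken componentwise since [Series] is
   real-valued; for f and g in [H_E xi] both component series converge
   absolutely. *)
Definition innerH (xi : nat -> R) (f g : C -> C) : C :=
  let t n := (coef f n * Cconj (coef g n) * RtoC (xi n ^ 2))%C in
  (Series (fun n => Re (t n)), Series (fun n => Im (t n))).

(* Operators are total maps on functions C -> C; only their restriction to
   [H_E xi] matters. *)
Definition bounded_operator (xi : nat -> R) (S : (C -> C) -> (C -> C)) : Prop :=
  (forall f, H_E xi f -> H_E xi (S f)) /\
  (forall (c : C) f g, H_E xi f -> H_E xi g ->
     S (fun z => (c * f z + g z)%C) = (fun z => (c * S f z + S g z)%C)) /\
  (exists K : R, forall f, H_E xi f -> normH xi (S f) <= K * normH xi f).

Definition isometry (xi : nat -> R) (S : (C -> C) -> (C -> C)) : Prop :=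
  bounded_operator xi S /\
  forall f, H_E xi f -> normH xi (S f) = normH xi f.

Definition is_adjoint (xi : nat -> R) (S S' : (C -> C) -> (C -> C)) : Prop :=
  bounded_operator xi S' /\
  forall f g, H_E xi f -> H_E xi g -> innerH xi (S f) g = innerH xi f (S' g).

Definition unitary (xi : nat -> R) (S : (C -> C) -> (C -> C)) : Prop :=
  bounded_operator xi S /\
  exists S', is_adjoint xi S S' /\
    forall f, H_E xi f -> S' (S f) = f /\ S (S' f) = f.

Definition comp_op (Phi : C -> C) (f : C -> C) : C -> C := fun z => f (Phi z).

(* Main.v *)
(** The product [C_{Phi2} C_{Phi1}] is composition with [z |-> m z + d], where
    [m = mu1 mu2] and [d = mu1 d2 + d1].  If [|m| = 1] and [d = 0] it multiplies
    the n-th coefficient by [m^n], and composition with [z |-> conj(m) z] is both its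
    adjoint and its inverse.  Conversely, comparing the norms of [z], [z + 1] and
    [z + i] with those of their images forces [Re d = Im d = 0] and then [|m| = 1]. *)

Require Import Defs.
From Stdlib Require Import Reals Lra Lia FunctionalExtensionality ClassicalEpsilon.
From Coquelicot Require Import Coquelicot.
Open Scope R_scope.

(** * Uniqueness of power series coefficients *)

Lemma Cmod_sqr (c : C) : Cmod c ^ 2 = Re c ^ 2 + Im c ^ 2.
Proof.
unfold Cmod, Re, Im; apply pow2_sqrt.
pose proof (pow2_ge_0 (fst c)); pose proof (pow2_ge_0 (snd c)); lra.
Qed.

(** [Re] and [Im] are additive, so they commute with partial sums, and a ball of [C] projects into
    balls of the two components. *)
Lemma is_series_Re_Im (u : nat -> C) (l : C) :
  @is_series C_AbsRing C_NormedModule u l ->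
  is_series (fun n => Re (u n)) (Re l) /\ is_series (fun n => Im (u n)) (Im l).
Proof.
intros H.
assert (E : forall n, Re (sum_n u n) = sum_n (fun k => Re (u k)) n /\
                      Im (sum_n u n) = sum_n (fun k => Im (u k)) n).
{ induction n as [|n [IH1 IH2]].
  - now rewrite !sum_O.
  - rewrite (sum_Sn u), (sum_Sn (fun k => Re (u k))),
      (sum_Sn (fun k => Im (u k))).
    split; [exact (f_equal2 Rplus IH1 eq_refl)
           | exact (f_equal2 Rplus IH2 eq_refl)]. }
split; apply filterlim_locally; intros eps;
  pose proof (proj1 (filterlim_locally (sum_n u) l) H) as H';
  specialize (H' eps); revert H'; apply filter_imp; intros n Hn.
- exact (eq_ind _ (@ball R_UniformSpace (Re l) eps) (proj1 Hn) _ (proj1 (E n))).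
- exact (eq_ind _ (@ball R_UniformSpace (Im l) eps) (proj2 Hn) _ (proj2 (E n))).
Qed.

Lemma pow_n_RtoC (x : R) (n : nat) :
  @pow_n C_Ring (RtoC x) n = RtoC (pow_n x n).
Proof.
induction n as [|n IH]; simpl; [reflexivity|].
rewrite IH; unfold mult; simpl; now rewrite <- RtoC_mult.
Qed.

(** Powers of a real point are real, so each term splits into the real and imaginary parts of its
    coefficient. This reduces uniqueness over [C] to uniqueness for two real series. *)
Lemma expands_real_line (f : C -> C) (a : nat -> C) (x : R) :
  expands f a ->
  is_pseries (fun n => Re (a n)) x (Re (f (RtoC x))) /\
  is_pseries (fun n => Im (a n)) x (Im (f (RtoC x))).
Proof.
intros H; destruct (is_series_Re_Im _ _ (H (RtoC x))) as [H1 H2].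
split; [revert H1 | revert H2]; apply is_series_ext; intros n;
  change (@pow_n (AbsRing.Ring C_AbsRing) (RtoC x) n)
    with (@pow_n C_Ring (RtoC x) n);
  rewrite pow_n_RtoC; unfold scal, mult, Re, Im; simpl; unfold mult; simpl;
  rewrite Rmult_0_l, ?Rminus_0_r, ?Rplus_0_r; reflexivity.
Qed.

Lemma real_pseries_unique (a b : nat -> R) (f : R -> R) :
  (forall x, is_pseries a x (f x)) -> (forall x, is_pseries b x (f x)) ->
  forall n, a n = b n.
Proof.
intros Ha Hb.
assert (P : forall c, (forall x, is_pseries c x (f x)) ->
              Rbar_lt 0 (CV_radius c)).
{ intros c Hc; apply Rbar_lt_le_trans with (Finite 1); [simpl; lra|].
  apply Rbar_not_lt_le; intros Hlt.
  (* A radius below 1 would keep the terms at 1 from tending to 0, although the series converges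
     there. *)
  apply (CV_disk_outside c 1).
  - now rewrite Rabs_R1.
  - assert (E : ex_series (fun n => c n * 1 ^ n)).
    { apply ex_pseries_R; exists (f 1); exact (Hc 1). }
    apply is_lim_seq_ext with (2 := ex_series_lim_0 _ E); reflexivity. }
intros n; apply PSeries_ext_recip; auto.
exists (mkposreal 1 Rlt_0_1); intros x _.
now rewrite (is_pseries_unique _ _ _ (Ha x)), (is_pseries_unique _ _ _ (Hb x)).
Qed.

Lemma expands_unique (f : C -> C) (a b : nat -> C) :
  expands f a -> expands f b -> forall n, a n = b n.
Proof.
intros Ha Hb n.
apply injective_projections.
- apply (real_pseries_unique (fun k => Re (a k)) (fun k => Re (b k))
           (fun x => Re (f (RtoC x)))); intros x;
    now apply expands_real_line.
- apply (real_pseries_unique (fun k => Im (a k)) (fun k => Im (b k))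
           (fun x => Im (f (RtoC x)))); intros x;
    now apply expands_real_line.
Qed.

(** An expansion exists, so the chosen [coef f] is one too, and uniqueness identifies it with
    [a]. *)
Lemma coef_expands (f : C -> C) (a : nat -> C) (n : nat) :
  expands f a -> coef f n = a n.
Proof.
intros H; apply (expands_unique f); auto.
apply (epsilon_spec (inhabits (fun _ : nat => RtoC 0)) (expands f)).
now exists a.
Qed.

Lemma normH_expands (xi : nat -> R) (f : C -> C) (a : nat -> C) :
  expands f a -> normH xi f = sqrt (Series (fun n => Cmod (a n) ^ 2 * xi n ^ 2)).
Proof.
intros H; unfold normH; f_equal; apply Series_ext; intros n.
now rewrite (coef_expands f a n H).
Qed.

(** Lets the adjoint identity be applied to norms. *)
Lemma normH_innerH (xi : nat -> R) (f : C -> C) :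
  normH xi f = sqrt (Re (innerH xi f f)).
Proof.
unfold normH, innerH; cbn [Re fst]; f_equal; apply Series_ext; intros n.
rewrite Cmod_sqr; unfold Re, Im; simpl; ring.
Qed.

(** * Norms of affine functions and the necessary conditions *)

Lemma is_series_two_terms {K : AbsRing} {V : NormedModule K} (u : nat -> V) :
  (forall n, u (S (S n)) = zero) -> is_series u (plus (u 0%nat) (u 1%nat)).
Proof.
intros H; unfold is_series.
apply filterlim_ext_loc with (f := fun _ : nat => plus (u 0%nat) (u 1%nat)).
- exists 1%nat; intros n Hn.
  destruct n as [|n]; [lia|clear Hn].
  induction n as [|n IH].
  + now rewrite sum_Sn, sum_O.
  + now rewrite sum_Sn, <- IH, H, plus_zero_r.
- apply filterlim_const.
Qed.

Definition affine_coef (b c : C) (n : nat) : C :=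
  match n with 0%nat => c | 1%nat => b | _ => RtoC 0 end.

Lemma expands_affine (b c : C) :
  expands (fun z => (b * z + c)%C) (affine_coef b c).
Proof.
intros z.
pose (u := fun k => @scal C_AbsRing C_NormedModule (@pow_n C_AbsRing z k)
                      (affine_coef b c k)).
replace (b * z + c)%C with (@plus C_NormedModule (u 0%nat) (u 1%nat)).
- apply (@is_series_two_terms C_AbsRing C_NormedModule u).
  intros n; apply (@scal_zero_r C_AbsRing C_NormedModule).
- unfold u; simpl; unfold scal, plus, mult, one; simpl.
  unfold mult, one; simpl; ring.
Qed.

Lemma is_series_affine_norm (xi : nat -> R) (b c : C) :
  is_series (fun n => Cmod (affine_coef b c n) ^ 2 * xi n ^ 2)
    (Cmod c ^ 2 * xi 0%nat ^ 2 + Cmod b ^ 2 * xi 1%nat ^ 2).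
Proof.
apply (is_series_two_terms (V := R_NormedModule)
         (fun n => Cmod (affine_coef b c n) ^ 2 * xi n ^ 2)).
intros n; simpl; rewrite Cmod_0; unfold zero; simpl; ring.
Qed.

Lemma H_E_affine (xi : nat -> R) (b c : C) : H_E xi (fun z => (b * z + c)%C).
Proof.
exists (affine_coef b c); split; [apply expands_affine|].
eexists; apply is_series_affine_norm.
Qed.

Lemma normH_affine (xi : nat -> R) (b c : C) :
  normH xi (fun z => (b * z + c)%C) =
  sqrt (Cmod c ^ 2 * xi 0%nat ^ 2 + Cmod b ^ 2 * xi 1%nat ^ 2).
Proof.
rewrite (normH_expands _ _ _ (expands_affine b c)); f_equal.
apply is_series_unique, is_series_affine_norm.
Qed.

Lemma norm_preserving_affine (xi : nat -> R) (m d : C) :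
  (forall n, 0 < xi n) ->
  (forall f, H_E xi f -> normH xi (fun z => f (m * z + d)%C) = normH xi f) ->
  Cmod m = 1 /\ d = RtoC 0.
Proof.
intros xi_pos H.
(* The test function [z + c] is sent to [m z + (d + c)]; [E] equates their squared norms. *)
assert (E : forall c : C,
  Cmod (d + c)%C ^ 2 * xi 0%nat ^ 2 + Cmod m ^ 2 * xi 1%nat ^ 2 =
  Cmod c ^ 2 * xi 0%nat ^ 2 + xi 1%nat ^ 2).
{ intros c.
  pose proof (H _ (H_E_affine xi (RtoC 1) c)) as Hc; cbv beta in Hc.
  replace (fun z : C => (1 * (m * z + d) + c)%C)
    with (fun z : C => (m * z + (d + c))%C) in Hc
    by (apply functional_extensionality; intros z; ring).
  rewrite !normH_affine, Cmod_1, pow1, Rmult_1_l in Hc.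
  apply sqrt_inj in Hc; [exact Hc| |];
    apply Rplus_le_le_0_compat; try apply pow2_ge_0;
    apply Rmult_le_pos; apply pow2_ge_0. }
pose proof (E (RtoC 0)) as E0; pose proof (E (RtoC 1)) as E1;
  pose proof (E Ci) as Ei.
rewrite !Cmod_sqr in E0, E1, Ei; unfold Re, Im in *; simpl in E0, E1, Ei.
pose proof (pow_lt _ 2 (xi_pos 0%nat)) as P0.
pose proof (pow_lt _ 2 (xi_pos 1%nat)) as P1.
simpl in P0, P1.
(* Subtracting [E0] from [E1] leaves 2 Re d times the square of [xi 0]; with [Ei] it is 2 Im d.
   Positivity of [xi 0] allows the cancellation. *)
assert (D1 : fst d = 0).
{ apply Rmult_eq_reg_r with (xi 0%nat * (xi 0%nat * 1)); lra. }
assert (D2 : snd d = 0).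
{ apply Rmult_eq_reg_r with (xi 0%nat * (xi 0%nat * 1)); lra. }
split; [|now apply injective_projections].
(* With d = 0, [E0] says that |m|^2 times the square of [xi 1] is that square. *)
rewrite D1, D2 in E0.
assert (M : Cmod m ^ 2 = 1).
{ rewrite Cmod_sqr; unfold Re, Im; simpl.
  apply Rmult_eq_reg_r with (xi 1%nat * (xi 1%nat * 1)); lra. }
pose proof (Cmod_ge_0 m); nra.
Qed.

(** * Dilations and rotations *)

Definition dilation (m : C) (f : C -> C) : C -> C := fun z => f (m * z)%C.

Lemma expands_dilation (m : C) (f : C -> C) (a : nat -> C) :
  expands f a -> expands (dilation m f) (fun n => (a n * m ^ n)%C).
Proof.
intros H z.
generalize (H (m * z)%C); unfold dilation.
apply is_series_ext; intros n.
(* The ring power [pow_n] is turned into the power of [C], so that (m z)^n splits as m^n z^n. *)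
assert (P : forall w : C, @pow_n C_AbsRing w n = (w ^ n)%C).
{ intros w; induction n as [|k IH]; simpl; [reflexivity|].
  rewrite IH; reflexivity. }
rewrite (P (m * z)%C), Cpow_mult_l; unfold scal; simpl; unfold mult; simpl.
rewrite (P z); ring.
Qed.

Section Rotation.

Variables (xi : nat -> R) (m : C).
Hypothesis m_unit : Cmod m = 1.

Lemma Cmod_rotation_coef (a : nat -> C) (n : nat) :
  Cmod (a n * m ^ n)%C = Cmod (a n).
Proof. now rewrite Cmod_mult, Cmod_pow, m_unit, pow1, Rmult_1_r. Qed.

Lemma H_E_rotation (f : C -> C) : H_E xi f -> H_E xi (dilation m f).
Proof.
intros (a & Ha & Hs).
exists (fun n => (a n * m ^ n)%C); split; [now apply expands_dilation|].
revert Hs; apply ex_series_ext; intros n; now rewrite Cmod_rotation_coef.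
Qed.

Lemma normH_rotation (f : C -> C) :
  H_E xi f -> normH xi (dilation m f) = normH xi f.
Proof.
intros (a & Ha & _).
rewrite (normH_expands _ _ _ Ha), (normH_expands _ _ _ (expands_dilation m f a Ha)).
f_equal; apply Series_ext; intros n; now rewrite Cmod_rotation_coef.
Qed.

Lemma bounded_rotation : bounded_operator xi (dilation m).
Proof.
split; [exact H_E_rotation|split].
- reflexivity.
(* The bound is 1 because the norm is preserved. *)
- exists 1; intros f Hf; rewrite normH_rotation by assumption; lra.
Qed.

Lemma isometry_rotation : isometry xi (dilation m).
Proof. split; [exact bounded_rotation | exact normH_rotation]. Qed.

End Rotation.

(** Since m conj(m) = 1, rotation by conj(m) inverts rotation by m. It is also the adjoint:
    conjugating conj(m)^n b_n yields m^n conj(b_n), so the two inner products agree term by term. *)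
Lemma unitary_rotation (xi : nat -> R) (m : C) :
  Cmod m = 1 -> unitary xi (dilation m).
Proof.
intros Hm.
assert (Hc : Cmod (Cconj m) = 1) by now rewrite Cmod_conj.
assert (Hmm : (m * Cconj m)%C = RtoC 1)
  by (rewrite <- Cmod2_conj, Hm; f_equal; ring).
split; [now apply bounded_rotation|].
exists (dilation (Cconj m)); split; [split|].
- now apply bounded_rotation.
- intros f g (a & Ha & _) (b & Hb & _); unfold innerH.
  assert (T : forall n,
    (coef (dilation m f) n * Cconj (coef g n) * RtoC (xi n ^ 2))%C =
    (coef f n * Cconj (coef (dilation (Cconj m) g) n) * RtoC (xi n ^ 2))%C).
  { intros n.
    rewrite (coef_expands _ _ n Ha), (coef_expands _ _ n Hb),
      (coef_expands _ _ n (expands_dilation m f a Ha)),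
      (coef_expands _ _ n (expands_dilation (Cconj m) g b Hb)),
      Cmult_conj, Cpow_conj, Cconj_conj.
    ring. }
  f_equal; apply Series_ext; intros n; now rewrite T.
- intros f _; unfold dilation.
  split; apply functional_extensionality; intros z; f_equal;
    rewrite Cmult_assoc, ?(Cmult_comm (Cconj m)), Hmm; apply Cmult_1_l.
Qed.

(** The chain is <Sf, Sf> = <f, S'Sf> = <f, f>. *)
Lemma unitary_isometry (xi : nat -> R) (S : (C -> C) -> (C -> C)) :
  unitary xi S -> isometry xi S.
Proof.
intros (HS & S' & (_ & Hadj) & Hinv); split; [exact HS|].
intros f Hf.
rewrite !normH_innerH, Hadj by (try apply (proj1 HS); assumption).
now rewrite (proj1 (Hinv f Hf)).
Qed.

Theorem theorem2p8 (xi : nat -> R)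
    (xi_pos : forall n, 0 < xi n)
    (xi_lim : is_lim_seq (fun n => Rpower (xi n) (/ INR n)) p_infty)
    (mu1 mu2 d1 d2 : C) (hmu1 : Cmod mu1 <= 1) (hmu2 : Cmod mu2 <= 1)
    (Phi1 Phi2 : C -> C)
    (hPhi1 : forall z : C, Phi1 z = (mu1 * z + d1)%C)
    (hPhi2 : forall z : C, Phi2 z = (mu2 * z + d2)%C)
    (hb1 : bounded_operator xi (comp_op Phi1))
    (hb2 : bounded_operator xi (comp_op Phi2)) :
  (isometry xi (fun f => comp_op Phi2 (comp_op Phi1 f)) <->
     Cmod mu1 = 1 /\ Cmod mu2 = 1 /\ (mu1 * d2 + d1)%C = RtoC 0) /\
  (unitary xi (fun f => comp_op Phi2 (comp_op Phi1 f)) <->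
     Cmod mu1 = 1 /\ Cmod mu2 = 1 /\ (mu1 * d2 + d1)%C = RtoC 0).
Proof.
(* The product sends f to the map z |-> f(Phi1(Phi2 z)), with [Phi2] innermost; hence the constant
   term mu1 d2 + d1. *)
replace (fun f => comp_op Phi2 (comp_op Phi1 f))
  with (fun (f : C -> C) (z : C) => f (mu1 * mu2 * z + (mu1 * d2 + d1))%C).
2:{ apply functional_extensionality; intros f.
    apply functional_extensionality; intros z; unfold comp_op.
    rewrite hPhi2, hPhi1; f_equal; ring. }
set (S := fun (f : C -> C) (z : C) => f (mu1 * mu2 * z + (mu1 * d2 + d1))%C).
assert (Hrot : (mu1 * d2 + d1)%C = RtoC 0 -> S = dilation (mu1 * mu2)).
{ intros Hd; apply functional_extensionality; intros f.
  apply functional_extensionality; intros z; unfold S, dilation.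
  rewrite Hd; f_equal; ring. }
assert (Hnec : isometry xi S ->
  Cmod mu1 = 1 /\ Cmod mu2 = 1 /\ (mu1 * d2 + d1)%C = RtoC 0).
{ intros [_ HS].
  destruct (norm_preserving_affine xi _ _ xi_pos HS) as [Hm Hd].
  rewrite Cmod_mult in Hm.
  pose proof (Cmod_ge_0 mu1); pose proof (Cmod_ge_0 mu2).
  (* Two numbers in [0, 1] with product 1 are both 1. *)
  repeat split; [nra | nra | exact Hd]. }
split; split.
- exact Hnec.
- intros (H1 & H2 & Hd); rewrite (Hrot Hd); apply isometry_rotation.
  rewrite Cmod_mult, H1, H2; ring.
(* A unitary operator is an isometry, so the necessary conditions carry over. *)
- intros HS; now apply Hnec, unitary_isometry.
- intros (H1 & H2 & Hd); rewrite (Hrot Hd); apply unitary_rotation.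
  rewrite Cmod_mult, H1, H2; ring.
Qed.
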